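(* Let $\Omega$ be an atomless Borel probability space with measure $\nu$ and let $W:\Omega^2\to[0,1]$ be a bipartite graphon. Then every extreme point $\mathfrak c$ of the set $\mathrm{FCOV}(W)$ of all fractional vertex covers of $W$ is integral, i.e. $\mathfrak c(x)\in\{0,1\}$ for almost every $x\in\Omega$.
   Context: A graphon is a symmetric measurable function $W:\Omega^2\to[0,1]$. Write $\operatorname{supp} W=\{(x,y): W(x,y)>0\}$. A graphon $W$ is bipartite if there is a partition $\Omega=\Omega_1\sqcup\Omega_2$ into measurable sets such that for $i=1,2$, $W=0$ almost everywhere on $\Omega_i\times\Omega_i$. A fractional vertex cover of $W$ is a function $\mathfrak c\in L^\infty(\Omega)$ such that $0\le\mathfrak c\le 1$ almost everywhere and the set $\operatorname{supp}W\setminus\{(x,y):\mathfrak c(x)+\mathfrak c(y)\ge 1\}$ has $\nu^{\otimes 2}$-measure $0$. $\mathrm{FCOV}(W)\subseteq L^\infty(\Omega)$ is the (convex) set of all fractional vertex covers of $W$. A point $x$ of a convex set $X$ is extreme if the only pair $x',x''\in X$ with $x=\frac12(x'+x'')$ is $x'=x''=x$. *)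

(* Defs.v *)
From HB Require Import structures.
From mathcomp Require Import all_boot all_order all_algebra.
From mathcomp Require Import all_classical all_reals all_analysis.
Set Implicit Arguments.
Unset Strict Implicit.
Unset Printing Implicit Defensive.
Import Order.TTheory GRing.Theory Num.Theory.
Import numFieldNormedType.Exports.
Local Open Scope classical_set_scope.
Local Open Scope ring_scope.

(* T is Borel isomorphic to a Polish space P. A Hausdorff pseudometric space is
   a metric space, and for it separability is the same as second countability. *)
Definition standard_borel (R : realType) (d : measure_display)
    (T : measurableType d) : Prop :=
  exists (P : completePseudoMetricType R) (f : T -> P),
    [/\ hausdorff_space P, @second_countable P, bijective f &
        @measurable d T = [set f @^-1` B | B in <<s @open P >>]].

Definition atomless (R : realType) (d : measure_display) (T : measurableType d)
    (nu : {measure set T -> \bar R}) : Prop :=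
  forall A : set T, measurable A -> (0 < nu A)%E ->
    exists B : set T,
      [/\ measurable B, B `<=` A, (0 < nu B)%E & (nu B < nu A)%E].

Definition graphon (R : realType) (d : measure_display) (T : measurableType d)
    (W : T * T -> R) : Prop :=
  [/\ measurable_fun [set: T * T] W,
      forall x y : T, W (x, y) = W (y, x) &
      forall z : T * T, 0 <= W z <= 1].

Definition supp (R : realType) (T : Type) (W : T * T -> R) : set (T * T) :=
  [set z | 0 < W z].

Section graphon_covers.
Context (R : realType) (d : measure_display) (T : measurableType d).
Variable nu : probability T R.
Implicit Types W : T * T -> R.

Definition bipartite W : Prop :=
  exists Om1 Om2 : set T,
    [/\ measurable Om1, measurable Om2,
        Om1 `|` Om2 = setT & Om1 `&` Om2 = set0] /\
    (\forall z \ae (nu \x nu)%E, (Om1 `*` Om1) z -> W z = 0) /\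
    (\forall z \ae (nu \x nu)%E, (Om2 `*` Om2) z -> W z = 0).

(* Measurable functions with finite essential supremum norm: representatives of
   the elements of L^oo(nu). Equality in L^oo(nu) is equality [%[ae nu]]. *)
Definition Linfty : Type := LfunType nu (leey (1%E : \bar R)).

Definition FCOV W : set Linfty :=
  [set c : Linfty |
    (\forall x \ae nu, 0 <= c x <= 1) /\
    (nu \x nu)%E (supp W `\` [set z | 1 <= c z.1 + c z.2]) = 0%E].

(* Extreme points of a subset of L^oo(nu) given by representatives; both
   equalities of the definition are those of L^oo(nu). *)
Definition extreme_point (X : set Linfty) (c : Linfty) : Prop :=
  X c /\
  forall c' c'' : Linfty, X c' -> X c'' ->
    c = (fun x => 2^-1 * (c' x + c'' x)) %[ae nu] ->
    c' = c %[ae nu] /\ c'' = c %[ae nu].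

Definition integral_cover (c : Linfty) : Prop :=
  \forall x \ae nu, c x = 0 \/ c x = 1.

End graphon_covers.

(* Main.v *)
(* A cover c is perturbed by g = min(c, 1 - c), with sign + on one side of the
   bipartition and - on the other. Both resulting functions are again covers:
   on an edge only one of the two values decreases, and where c x < 1/2 the
   constraint c x + c y >= 1 forces c y > 1/2, so that the loss 1 - c y is at
   most the gain c x. Since c is their midpoint, extremality gives g = 0
   almost everywhere, i.e. c takes values in {0, 1}. *)
Require Import Defs.
From HB Require Import structures.
From mathcomp Require Import all_boot all_order all_algebra.
From mathcomp Require Import all_classical all_reals all_analysis.
From mathcomp Require Import measurable_realfun ess_sup_inf lra.
Set Implicit Arguments.
Unset Strict Implicit.
Unset Printing Implicit Defensive.
Import Order.TTheory GRing.Theory Num.Theory.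
Import numFieldNormedType.Exports.
Local Open Scope classical_set_scope.
Local Open Scope ring_scope.

(** Brings functions built pointwise back into the bundled type [Linfty]. The equality holds
    everywhere, so replacing [g] by [f] costs no null set. *)
Lemma ae_bounded_Linfty (R : realType) (d : measure_display)
    (T : measurableType d) (nu : probability T R) (f : T -> R) (M : R) :
  measurable_fun [set: T] f -> (\forall x \ae nu, `|f x| <= M) ->
  exists g : Linfty nu, g = f :> (T -> R).
Proof.
move=> mf fM.
have finf : finite_norm nu +oo%E f.
  rewrite /finite_norm unlock; have -> : (0 < nu [set: T])%E by rewrite probability_setT lte01.
  apply: (@le_lt_trans _ _ M%:E); last exact: ltry.
  by apply/ess_supP; apply: filterS fM => x /=; rewrite lee_fin.
pose hm := @isMeasurableFun.Build _ _ T R f mf.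
pose hf := @isLfunction.Build _ _ _ nu +oo%E (leey _) (HB.pack_for {mfun T >-> R} f hm) finf.
by exists (HB.pack_for (Linfty nu) f hm hf).
Qed.

Section cover_shift.
Context (R : realType).
Implicit Types a b : R.

(* [raise a = a + min(a, 1 - a)] and [lower a = a - min(a, 1 - a)]. *)
Definition raise a : R := Num.min (2 * a) 1.
Definition lower a : R := Num.max 0 (2 * a - 1).

Lemma raiseDlower a : raise a + lower a = 2 * a.
Proof. by rewrite /raise /lower minEle maxEle; case: ifPn; case: ifPn; lra. Qed.

Lemma raise_itv a : 0 <= a <= 1 -> 0 <= raise a <= 1.
Proof. by rewrite /raise minEle; case: ifPn; lra. Qed.

Lemma lower_itv a : 0 <= a <= 1 -> 0 <= lower a <= 1.
Proof. by rewrite /lower maxEle; case: ifPn; lra. Qed.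

(** If [raise a] is 1, then [lower b >= 0] suffices; otherwise the sum is at least 2a + (2b - 1) =
    2(a + b) - 1 >= 1. *)
Lemma raise_lower_cover a b : 1 <= a + b -> 1 <= raise a + lower b.
Proof. by rewrite /raise /lower minEle maxEle; case: ifPn; case: ifPn; lra. Qed.

Lemma raise_id a : raise a = a -> a = 0 \/ a = 1.
Proof. by rewrite /raise minEle; case: ifPn => _; [left|right]; lra. Qed.

Lemma lower_id a : lower a = a -> a = 0 \/ a = 1.
Proof. by rewrite /lower maxEle; case: ifPn => _; [right|left]; lra. Qed.

End cover_shift.

Section fractional_covers.
Context (R : realType) (d : measure_display) (T : measurableType d).
Variables (nu : probability T R) (W : T * T -> R).
Hypothesis mW : measurable_fun [set: T * T] W.

(** Passing from [A] to its complement reverses the sign of the perturbation, so this one function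
    provides both covers. *)
Definition shift (A : set T) (c : T -> R) (x : T) : R :=
  if x \in A then raise (c x) else lower (c x).

Lemma measurable_shift (A : set T) (c : T -> R) :
  measurable A -> measurable_fun [set: T] c -> measurable_fun [set: T] (shift A c).
Proof.
move=> mA mc.
have m2c : measurable_fun [set: T] (fun x => 2 * c x).
  by apply: measurable_funM.
apply: measurable_fun_ifT.
- apply: (measurable_fun_bool true); rewrite setTI.
  by rewrite (_ : _ @^-1` _ = A)//; apply/seteqP; split => x; [exact: set_mem|exact: mem_set].
- exact: measurable_minr.
- by apply: measurable_maxr => //; exact: measurable_funB.
Qed.

Lemma shift_FCOV (A : set T) (c : Linfty nu) : measurable A ->
  (\forall z \ae (nu \x nu)%E, (A `*` A) z -> W z = 0) ->
  (\forall z \ae (nu \x nu)%E, (~` A `*` ~` A) z -> W z = 0) ->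
  FCOV W c ->
  exists2 s : Linfty nu, FCOV W s & s = shift A c :> (T -> R).
Proof.
move=> mA WA WAC [c01 ccov].
have mc : measurable_fun [set: T] c by [].
have ms := measurable_shift mA mc.
have s01 : \forall x \ae nu, 0 <= shift A c x <= 1.
  apply: filterS c01 => x; rewrite /shift.
  by case: ifP => _; [exact: raise_itv|exact: lower_itv].
have [|s sE] := ae_bounded_Linfty (nu := nu) (M := 1) ms.
  by apply: filterS s01 => x /andP[s0 s1]; rewrite ger0_norm.
exists s => //; split; rewrite sE//.
(* [FCOV] speaks of measure zero, the pointwise argument of almost every edge. Measurability of the
   uncovered edges allows passing from one to the other, for [c] and back for its shift. *)
have mbad (f : T -> R) : measurable_fun [set: T] f ->
    measurable (supp W `\` [set z | 1 <= f z.1 + f z.2]).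
  move=> mf; apply: measurableD.
    rewrite -[supp W]setTI.
    exact: (measurable_fun_ltr (measurable_cst (0 : R)) mW measurableT (Y := [set true])).
  rewrite -[X in measurable X]setTI; apply: measurable_fun_le => //.
  by apply: measurable_funD; exact: measurableT_comp.
apply: measure_negligible; first exact: mbad.
have Ac : \forall z \ae (nu \x nu)%E, supp W z -> 1 <= c z.1 + c z.2.
  exists (supp W `\` [set z | 1 <= c z.1 + c z.2]); split => //; first exact: mbad.
  by move=> z /= /not_implyP.
have As : \forall z \ae (nu \x nu)%E, supp W z -> 1 <= shift A c z.1 + shift A c z.2.
  apply: filterS3 Ac WA WAC => -[x y] /= xyc xyA xyAC Wxy.
  have Wn0 : W (x, y) <> 0 by move: Wxy; rewrite /supp/= => /lt0r_neq0/eqP.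
  (* An edge inside [A] or inside its complement contradicts [W (x, y) <> 0]; a crossing edge has
     one end raised and the other lowered. *)
  rewrite /shift; case: ifPn => xA; case: ifPn => yA.
  - by move: xA yA; rewrite !inE => xA yA; case: Wn0; exact: xyA.
  - exact/raise_lower_cover/xyc.
  - by rewrite addrC; apply: raise_lower_cover; rewrite addrC; exact: xyc.
  - by move: xA yA; rewrite !notin_setE => xA yA; case: Wn0; exact: xyAC.
by apply: negligibleS As => z /= [Wz scov] /(_ Wz).
Qed.

End fractional_covers.

Theorem theorem14 (R : realType) (d : measure_display) (T : measurableType d)
    (nu : probability T R) (W : T * T -> R)
    (hT : standard_borel R T) (hnu : atomless nu)
    (hW : graphon W) (hbip : bipartite nu W)
    (c : Linfty nu) (hc : extreme_point (FCOV W) c) :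
  integral_cover c.
Proof.
have [mW _ _] := hW.
have [Om1 [Om2 [[mOm1 mOm2 Om12 Om12_disj] [W1 W2]]]] := hbip.
have Om2E : Om2 = ~` Om1.
  apply/seteqP; split=> x.
    by move=> x2 x1; rewrite -[False]/(set0 x) -Om12_disj.
  by move=> x1; have : [set: T] x by []; rewrite -Om12 => -[].
rewrite {}Om2E in mOm2 W2 Om12 Om12_disj.
have [cF cext] := hc.
have [s sF sE] := shift_FCOV mW mOm1 W1 W2 cF.
have [|t tF tE] := shift_FCOV mW mOm2 W2 _ cF; first by rewrite setCK.
have [|sc _] := cext _ _ sF tF.
  (* At each point exactly one of [s], [t] raises and the other lowers, so [c] is their midpoint
     everywhere. *)
  apply: nearW => x _; rewrite sE tE /shift in_setC.
  by case: (x \in Om1) => /=; rewrite ?[lower _ + _]addrC raiseDlower mulKf.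
(* Where [s] and [c] agree, [c x] is a fixed point of [raise] or of [lower]. *)
apply: filterS sc => x /(_ I); rewrite sE /shift.
by case: ifP => _; [exact: raise_id|exact: lower_id].
Qed.
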